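(* Let $d,n\in\mathbb{N}$ and let $a\in \mathrm{Y}_{d,n}(q)$. Then $\mathrm{tr}_d(a)=\mathrm{tr}_d(\overleftarrow{a})$. In particular, $\mathrm{tr}_d(\alpha)=\mathrm{tr}_d(\overleftarrow{\alpha})$ for all framed braids $\alpha\in\mathcal{F}_n$.
   Context: Framed braid group: $\mathcal{F}_n\cong\mathbb{Z}^n\rtimes B_n$ is generated by the braid generators $\sigma_1,\dots,\sigma_{n-1}$ of the classical braid group $B_n$ and framing generators $t_1,\dots,t_n$, with relations $\sigma_i\sigma_j\sigma_i=\sigma_j\sigma_i\sigma_j$ for $|i-j|=1$; $\sigma_i\sigma_j=\sigma_j\sigma_i$ for $|i-j|>1$; $t_it_j=t_jt_i$; $t_j\sigma_i=\sigma_i t_{s_i(j)}$, where $s_i=(i,i+1)$. Let $\mathcal{F}_{d,n}$ be the quotient by the relations $t_j^d=1$ for all $j$, and put $e_i:=\frac1d\sum_{s=1}^{d}t_i^st_{i+1}^{-s}\in\mathbb{C}\mathcal{F}_{d,n}$ for $1\le i\le n-1$. Yokonuma--Hecke algebra: for fixed $q\in\mathbb{C}\setminus\{0\}$, $\mathrm{Y}_{d,n}(q)$ is the quotient of $\mathbb{C}\mathcal{F}_{d,n}$ by the ideal generated by $\sigma_i^2-1-(q-q^{-1})e_i\sigma_i$ ($1\le i\le n-1$). The image of $\sigma_i$ is denoted $g_i$, and that of $t_j$ is still denoted $t_j$. There are natural inclusions $\mathrm{Y}_{d,n}(q)\subset \mathrm{Y}_{d,n+1}(q)$. Trace: for indeterminates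 $z,x_1,\dots,x_{d-1}$, $\mathrm{tr}_d:\bigcup_{n\ge0}\mathrm{Y}_{d,n}(q)\to\mathbb{C}[z,x_1,\dots,x_{d-1}]$ is the unique linear map (Juyumaya) such that $\mathrm{tr}_d(ab)=\mathrm{tr}_d(ba)$, $\mathrm{tr}_d(1)=1$, $\mathrm{tr}_d(ag_n)=z\,\mathrm{tr}_d(a)$ and $\mathrm{tr}_d(at_{n+1}^s)=x_s\,\mathrm{tr}_d(a)$ ($1\le s\le d-1$) for all $n$ and all $a,b\in \mathrm{Y}_{d,n}(q)$. For $\alpha\in\mathcal{F}_n$, $\mathrm{tr}_d(\alpha)$ denotes $\mathrm{tr}_d$ of the image of $\alpha$ under the natural homomorphism $\sigma_i\mapsto g_i$, $t_j\mapsto t_j$. Inversion: for $\alpha=t_1^{k_1}\cdots t_n^{k_n}\sigma_{i_1}^{l_1}\cdots\sigma_{i_r}^{l_r}\in\mathcal{F}_n$, $\overleftarrow{\alpha}:=\sigma_{i_r}^{l_r}\cdots\sigma_{i_1}^{l_1}t_n^{k_n}\cdots t_1^{k_1}$ (the word read from right to left). On $\mathrm{Y}_{d,n}(q)$, $a\mapsto\overleftarrow{a}$ is the $\mathbb{C}$-linear extension of reversal of words in the generators $g_i^{\pm1},t_j^{\pm1}$, i.e. the $\mathbb{C}$-algebra antiautomorphism fixing every $g_i$ and $t_j$. *)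

(* Defs.v *)
From HB Require Import structures.
From mathcomp Require Import all_boot all_order all_fingroup all_algebra.
From mathcomp Require Import generic_quotient ring_quotient.
From mathcomp Require Import boolp reals complex finmap.
From mathcomp Require monalg mpoly.

Set Implicit Arguments.
Unset Strict Implicit.
Unset Printing Implicit Defensive.

Import GRing.Theory.

Section PresentedGroup.
Local Open Scope group_scope.
Local Open Scope quotient_scope.
Variable I : choiceType.

(* The letter (i, false) stands for the generator i, and (i, true) for its
   inverse. *)
Definition word : Type := seq (I * bool).
HB.instance Definition _ := Choice.on word.

Definition letter (i : I) : word := [:: (i, false)].
Definition word_inv (w : word) : word := rev [seq (x.1, ~~ x.2) | x <- w].

Variable R : word -> word -> Prop.

Inductive word_eq : word -> word -> Prop :=
| WordRel u v : R u v -> word_eq u v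
| WordCancel i b : word_eq [:: (i, b); (i, ~~ b)] [::]
| WordCat u u' v v' : word_eq u u' -> word_eq v v' -> word_eq (u ++ v) (u' ++ v')
| WordRefl u : word_eq u u
| WordSym u v : word_eq u v -> word_eq v u
| WordTrans v u w : word_eq u v -> word_eq v w -> word_eq u w.

Definition word_eqb : rel word := fun u v => `[< word_eq u v >].

Lemma word_eqb_equiv : equiv_class_of word_eqb.
Proof.
split=> [u|u v|v u w].
- exact/asboolP/WordRefl.
- by apply/idP/idP => /asboolP H; apply/asboolP; apply: WordSym.
- by move=> /asboolP H1 /asboolP H2; apply/asboolP; apply: WordTrans H1 H2.
Qed.
Canonical word_eqb_equiv_rel := EquivRelPack word_eqb_equiv.
Canonical word_eqb_encModRel := defaultEncModRel word_eqb.

Definition pres_group := {eq_quot word_eqb}.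
HB.instance Definition _ := Choice.on pres_group.
HB.instance Definition _ := EqQuotient.on pres_group.

Definition pres_pi (w : word) : pres_group := \pi_pres_group w.

Lemma pres_piP u v : (pres_pi u = pres_pi v) <-> word_eq u v.
Proof.
rewrite /pres_pi; split=> [/eqmodP/asboolP //|H].
by apply/eqmodP/asboolP.
Qed.

Lemma pres_pi_repr (x : pres_group) : pres_pi (repr x) = x.
Proof. exact: reprK. Qed.

Lemma repr_pres_pi w : word_eq (repr (pres_pi w)) w.
Proof. by apply/pres_piP; rewrite pres_pi_repr. Qed.

Definition pres_mul (x y : pres_group) := pres_pi (repr x ++ repr y).
Definition pres_inv (x : pres_group) := pres_pi (word_inv (repr x)).

Lemma pres_mul_pi u v : pres_mul (pres_pi u) (pres_pi v) = pres_pi (u ++ v).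
Proof. by apply/pres_piP/WordCat; apply: repr_pres_pi. Qed.

Lemma word_invK : involutive word_inv.
Proof.
move=> w; rewrite /word_inv map_rev revK -map_comp -[RHS]map_id.
by apply: eq_map => -[i b] /=; rewrite negbK.
Qed.

Lemma word_mulV w : word_eq (w ++ word_inv w) [::].
Proof.
elim: w => [|[i b] w IH]; first exact: WordRefl.
rewrite /word_inv /= rev_cons -cats1 -/(word_inv w).
have -> : (i, b) :: w ++ word_inv w ++ [:: (i, ~~ b)]
  = [:: (i, b)] ++ ((w ++ word_inv w) ++ [:: (i, ~~ b)]) by rewrite -catA.
apply: (WordTrans (v := [:: (i, b)] ++ ([::] ++ [:: (i, ~~ b)]))).
  by apply: WordCat (WordRefl _) _; apply: WordCat IH (WordRefl _).
exact: WordCancel.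
Qed.

Lemma word_mulVl w : word_eq (word_inv w ++ w) [::].
Proof. by have := word_mulV (word_inv w); rewrite word_invK. Qed.

Lemma word_cancel_inv u v : word_eq (u ++ v) [::] -> word_eq v (word_inv u).
Proof.
move=> H; have E : word_eq (word_inv u ++ (u ++ v)) (word_inv u).
  by rewrite -[X in word_eq _ X]cats0; apply: WordCat (WordRefl _) H.
apply: WordTrans E; rewrite catA -{1}[v]cat0s.
by apply: WordCat (WordRefl _); apply/WordSym/word_mulVl.
Qed.

Lemma pres_inv_pi w : pres_inv (pres_pi w) = pres_pi (word_inv w).
Proof.
apply/pres_piP/word_cancel_inv.
apply: WordTrans (word_mulV (repr (pres_pi w))).
by apply: WordCat (WordRefl _); apply/WordSym/repr_pres_pi.
Qed.

Lemma pres_mulA : associative pres_mul.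
Proof.
move=> x y z; rewrite -[x]pres_pi_repr -[y]pres_pi_repr -[z]pres_pi_repr.
by rewrite !pres_mul_pi catA.
Qed.
Lemma pres_mul1 : left_id (pres_pi [::]) pres_mul.
Proof. by move=> x; rewrite -[x]pres_pi_repr pres_mul_pi. Qed.
Lemma pres_mulr1 : right_id (pres_pi [::]) pres_mul.
Proof. by move=> x; rewrite -[x]pres_pi_repr pres_mul_pi cats0. Qed.
Lemma pres_mulV : left_inverse (pres_pi [::]) pres_inv pres_mul.
Proof.
move=> x; rewrite -[x]pres_pi_repr pres_inv_pi pres_mul_pi.
exact/pres_piP/word_mulVl.
Qed.
Lemma pres_mulrV : right_inverse (pres_pi [::]) pres_inv pres_mul.
Proof.
move=> x; rewrite -[x]pres_pi_repr pres_inv_pi pres_mul_pi.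
exact/pres_piP/word_mulV.
Qed.

HB.instance Definition _ := isGroup.Build pres_group
  pres_mulA pres_mul1 pres_mulr1 pres_mulV pres_mulrV.

Lemma pres_piM u v : pres_pi (u ++ v) = pres_pi u * pres_pi v.
Proof. by rewrite -pres_mul_pi. Qed.
Lemma pres_piV w : pres_pi (word_inv w) = (pres_pi w)^-1.
Proof. by rewrite -pres_inv_pi. Qed.
Lemma pres_pi1 : pres_pi [::] = 1.
Proof. by []. Qed.

Definition pres_gen (i : I) : pres_group := pres_pi (letter i).

Definition word_eval (G : groupType) (f : I -> G) (w : word) : G :=
  foldr (fun x y => (if x.2 then (f x.1)^-1 else f x.1) * y) 1 w.

Lemma word_eval_cat (G : groupType) (f : I -> G) u v :
  word_eval f (u ++ v) = word_eval f u * word_eval f v.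
Proof. by elim: u => [|x u IH] /=; rewrite ?mul1g // IH mulgA. Qed.

Lemma pres_pi_eval w : pres_pi w = word_eval pres_gen w.
Proof.
elim: w => [|[i b] w IH] //; rewrite -cat1s pres_piM IH /=.
by congr (_ * _); case: b => //; rewrite /pres_gen -pres_piV.
Qed.

(* [pres_lift f] and [pres_rev] below evaluate a chosen representative word.
   When R is compatible with f, resp. stable under reversal, the lemmas
   [pres_lift_pi] and [pres_rev_pi] show that this choice is irrelevant. *)
Definition pres_lift (G : groupType) (f : I -> G) (x : pres_group) : G :=
  word_eval f (repr x).

Lemma word_eq_eval (G : groupType) (f : I -> G) :
  (forall u v, R u v -> word_eval f u = word_eval f v) ->
  forall u v, word_eq u v -> word_eval f u = word_eval f v.
Proof.
move=> fR u v; elim=> {u v} //.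
- by move=> i [] /=; rewrite mulg1 ?mulVg ?mulgV.
- by move=> u u' v v' _ Eu _ Ev; rewrite !word_eval_cat Eu Ev.
- by move=> v u w _ -> _ ->.
Qed.

Lemma pres_lift_pi (G : groupType) (f : I -> G) w :
  (forall u v, R u v -> word_eval f u = word_eval f v) ->
  pres_lift f (pres_pi w) = word_eval f w.
Proof. by move=> fR; apply: (word_eq_eval fR); apply: repr_pres_pi. Qed.

Lemma pres_liftM (G : groupType) (f : I -> G) :
  (forall u v, R u v -> word_eval f u = word_eval f v) ->
  {morph pres_lift f : x y / x * y}.
Proof.
move=> fR x y; rewrite -[x]pres_pi_repr -[y]pres_pi_repr -pres_piM.
by rewrite !pres_lift_pi // word_eval_cat.
Qed.

Definition pres_rev (x : pres_group) : pres_group := pres_pi (rev (repr x)).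

Lemma word_eq_rev : (forall u v, R u v -> word_eq (rev u) (rev v)) ->
  forall u v, word_eq u v -> word_eq (rev u) (rev v).
Proof.
move=> revR u v; elim=> {u v}; first exact: revR.
- by move=> i b; have := WordCancel i (~~ b); rewrite negbK.
- by move=> u u' v v' _ Eu _ Ev; rewrite !rev_cat; apply: WordCat.
- by move=> u; apply: WordRefl.
- by move=> u v _; apply: WordSym.
- by move=> v u w _ H1 _ H2; apply: WordTrans H1 H2.
Qed.

Lemma pres_rev_pi w : (forall u v, R u v -> word_eq (rev u) (rev v)) ->
  pres_rev (pres_pi w) = pres_pi (rev w).
Proof.
by move=> revR; apply/pres_piP; apply: (word_eq_rev revR); apply: repr_pres_pi.
Qed.

Lemma pres_revM : (forall u v, R u v -> word_eq (rev u) (rev v)) ->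
  {morph pres_rev : x y / x * y >-> y * x}.
Proof.
move=> revR x y; rewrite -[x]pres_pi_repr -[y]pres_pi_repr -pres_piM.
by rewrite !pres_rev_pi // rev_cat pres_piM.
Qed.

End PresentedGroup.

(* The library turns {malg K[M]} into a ring only when the monoid M has no
   nontrivial unit, so the convolution product is defined here. *)
Module Export GroupAlgebra.
Import monalg.
Local Open Scope ring_scope.

Definition galg (K : comNzRingType) (G : groupType) : Type := {malg K[G]}.
HB.instance Definition _ (K : comNzRingType) (G : groupType) :=
  GRing.Lmodule.on (galg K G).

(* The basis element g, the linear extension of a map given on the basis, and
   the convolution product are locked to keep unification away from supports. *)
HB.lock Definition gelt (K : comNzRingType) (G : groupType) (g : G) : galg K G :=
  << g >>.
HB.lock Definition galg_ext (K : comNzRingType) (G : groupType) (V : lmodType K)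
    (f : G -> V) (x : galg K G) : V :=
  (\sum_(g <- msupp (x : {malg K[G]})) (x : {malg K[G]})@_g *: f g)%R.
HB.lock Definition galg_mul (K : comNzRingType) (G : groupType) (x y : galg K G)
    : galg K G :=
  galg_ext (fun g => galg_ext (fun h => gelt K (g * h)%g) y) x.

Section Def.
Local Open Scope ring_scope.
Variables (K : comNzRingType) (G : groupType).

Local Notation galg := (galg K G).
Local Notation gelt := (@gelt K G).
Local Notation galg_mul := (@galg_mul K G).

Implicit Types x y : galg.

Lemma galgE x : x = \sum_(g <- msupp (x : {malg K[G]})) (x : {malg K[G]})@_g *: gelt g.
Proof.
rewrite {1}[x]monalgE; apply: eq_bigr => g _.
by apply/malgP => h; rewrite gelt.unlock mcoeffZ !mcoeffU mulr_natr.
Qed.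

Lemma galg_extE (V : lmodType K) (f : G -> V) x :
  galg_ext f x = \sum_(g <- msupp (x : {malg K[G]})) (x : {malg K[G]})@_g *: f g.
Proof. by rewrite galg_ext.unlock. Qed.

Lemma galg_extw (V : lmodType K) (f : G -> V) (D : {fset G}) x :
  (msupp (x : {malg K[G]}) `<=` D)%fset ->
  galg_ext f x = \sum_(g <- D) (x : {malg K[G]})@_g *: f g.
Proof.
move=> le; rewrite galg_ext.unlock (big_fset_incl _ le) => //= g _ /mcoeff_outdom ->.
by rewrite scale0r.
Qed.

Lemma galg_ext_is_linear (V : lmodType K) (f : G -> V) : linear (galg_ext f).
Proof.
move=> c x y; pose D := (msupp (x : {malg K[G]}) `|` msupp (y : {malg K[G]}))%fset.
rewrite (galg_extw f (D := D)); last first.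
  apply: fsubset_trans (msuppD_le _ _) _; apply: fsetSU; exact: msuppZ_le.
rewrite (galg_extw f (fsubsetUl _ _ : (_ `<=` D)%fset)).
rewrite (galg_extw f (fsubsetUr _ _ : (_ `<=` D)%fset)).
rewrite scaler_sumr -big_split; apply: eq_bigr => g _ /=.
by rewrite mcoeffD mcoeffZ scalerDl scalerA.
Qed.
HB.instance Definition _ (V : lmodType K) (f : G -> V) :=
  GRing.isLinear.Build K galg V *:%R (galg_ext f) (galg_ext_is_linear f).

Lemma galg_ext_gelt (V : lmodType K) (f : G -> V) g : galg_ext f (gelt g) = f g.
Proof.
by rewrite galg_ext.unlock gelt.unlock msuppU oner_eq0 big_seq_fset1 mcoeffUU scale1r.
Qed.

Lemma galg_lin_eq (V : lmodType K) (f1 f2 : {linear galg -> V}) :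
  (forall g, f1 (gelt g) = f2 (gelt g)) -> f1 =1 f2.
Proof.
move=> E x; rewrite [x]galgE !linear_sum; apply: eq_bigr => g _.
by rewrite !linearZ E.
Qed.

Lemma galg_mulDl : left_distributive galg_mul +%R.
Proof. by move=> x y z; rewrite !galg_mul.unlock linearD. Qed.

Lemma galg_mulZl c x y : galg_mul (c *: x) y = c *: galg_mul x y.
Proof. by rewrite !galg_mul.unlock linearZ. Qed.

Lemma galg_mulr_is_linear x : linear (galg_mul x).
Proof.
move=> c y z; rewrite !galg_mul.unlock ![galg_ext _ x]galg_extE scaler_sumr -big_split.
apply: eq_bigr => g _ /=; rewrite linearP.
by rewrite scalerDr !scalerA mulrC.
Qed.

Lemma galg_mulDr : right_distributive galg_mul +%R.
Proof. by move=> x y z; have := galg_mulr_is_linear x 1 y z; rewrite !scale1r. Qed.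

Lemma galg_mul0r x : galg_mul x 0 = 0.
Proof. by apply: (addrI (galg_mul x 0)); rewrite -galg_mulDr !addr0. Qed.

Lemma galg_mulZr c x y : galg_mul x (c *: y) = c *: galg_mul x y.
Proof.
by have := galg_mulr_is_linear x c y 0; rewrite !addr0 galg_mul0r addr0.
Qed.

Lemma galg_mul0l x : galg_mul 0 x = 0.
Proof. by rewrite !galg_mul.unlock linear0. Qed.

Lemma galg_mul_gelt g h : galg_mul (gelt g) (gelt h) = gelt (g * h)%g.
Proof. by rewrite galg_mul.unlock !galg_ext_gelt. Qed.

Lemma galg_ind (P : galg -> Prop) : P 0 -> (forall c g, P (c *: gelt g)) ->
  (forall x y, P x -> P y -> P (x + y)) -> forall x, P x.
Proof.
by move=> P0 Pg PD x; rewrite [x]galgE; apply: (big_ind P) => // g _; apply: Pg.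
Qed.

Lemma galg_mulA : associative galg_mul.
Proof.
move=> x y z; elim/galg_ind: x => [|a g|x x' Ex Ex'].
- by rewrite !galg_mul0l.
- elim/galg_ind: y => [|b h|y y' Ey Ey'].
  + by rewrite galg_mul0l galg_mul0r galg_mul0l.
  + elim/galg_ind: z => [|c k|z z' Ez Ez'].
    * by rewrite !galg_mul0r.
    * rewrite !(galg_mulZl, galg_mulZr) !galg_mul_gelt mulgA !scalerA.
      by rewrite [c * a * b]mulrAC [c * b * a]mulrC [c * b]mulrC mulrA.
    * by rewrite !galg_mulDr Ez Ez'.
  + by rewrite galg_mulDl !galg_mulDr galg_mulDl Ey Ey'.
- by rewrite !galg_mulDl Ex Ex'.
Qed.

Lemma galg_mul1l : left_id (gelt 1%g) galg_mul.
Proof.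
move=> x; elim/galg_ind: x => [|a g|x y Ex Ey].
- exact: galg_mul0r.
- by rewrite galg_mulZr galg_mul_gelt mul1g.
- by rewrite galg_mulDr Ex Ey.
Qed.

Lemma galg_mul1r : right_id (gelt 1%g) galg_mul.
Proof.
move=> x; elim/galg_ind: x => [|a g|x y Ex Ey].
- exact: galg_mul0l.
- by rewrite galg_mulZl galg_mul_gelt mulg1.
- by rewrite galg_mulDl Ex Ey.
Qed.

Lemma galg_oner_neq0 : gelt 1%g != 0.
Proof. by rewrite gelt.unlock; apply/eqP/malgP=> /(_ 1%g) /eqP; rewrite mcoeffUU mcoeff0 oner_eq0. Qed.

HB.instance Definition _ := GRing.Zmodule_isNzRing.Build galg
  galg_mulA galg_mul1l galg_mul1r galg_mulDl galg_mulDr galg_oner_neq0.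

HB.instance Definition _ := GRing.Lmodule_isLalgebra.Build K galg
  (fun c x y => esym (galg_mulZl c x y)).
HB.instance Definition _ := GRing.Lalgebra_isAlgebra.Build K galg
  (fun c x y => esym (galg_mulZr c x y)).

Lemma geltM g h : gelt (g * h)%g = gelt g * gelt h.
Proof. by rewrite -[LHS]galg_mul_gelt. Qed.
Lemma gelt1 : gelt 1%g = 1.
Proof. by []. Qed.

End Def.

Definition galg_map (K : comNzRingType) (G H : groupType) (f : G -> H)
  : {linear galg K G -> galg K H} := galg_ext (fun g => gelt K (f g)).

Lemma galg_map_gelt (K : comNzRingType) (G H : groupType) (f : G -> H) g :
  galg_map K f (gelt K g) = gelt K (f g).
Proof. exact: galg_ext_gelt. Qed.

Lemma galg_mapM (K : comNzRingType) (G H : groupType) (f : G -> H) :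
  {morph f : g h / (g * h)%g} ->
  {morph galg_map K f : x y / (x * y)%R}.
Proof.
move=> fM x y; elim/galg_ind: x => [|a g|x x' Ex Ex'].
- by rewrite mul0r linear0 mul0r.
- elim/galg_ind: y => [|b h|y y' Ey Ey'].
  + by rewrite mulr0 linear0 mulr0.
  + rewrite -scalerAl -scalerAr -geltM !linearZ -scalerAl -scalerAr.
    by rewrite !galg_map_gelt -geltM fM.
  + by rewrite mulrDr !linearD mulrDr Ey Ey'.
- by rewrite mulrDl !linearD mulrDl Ex Ex'.
Qed.

Lemma galg_mapM_rev (K : comNzRingType) (G H : groupType) (f : G -> H) :
  {morph f : g h / (g * h)%g >-> (h * g)%g} ->
  {morph galg_map K f : x y / (x * y)%R >-> (y * x)%R}.
Proof.
move=> fM x y; elim/galg_ind: x => [|a g|x x' Ex Ex'].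
- by rewrite mul0r linear0 mulr0.
- elim/galg_ind: y => [|b h|y y' Ey Ey'].
  + by rewrite mulr0 linear0 mul0r.
  + rewrite -scalerAl -scalerAr -geltM !linearZ !galg_map_gelt fM geltM /=.
    by rewrite -scalerAl -scalerAr !scalerA mulrC.
  + by rewrite mulrDr !linearD mulrDl Ey Ey'.
- by rewrite mulrDl !linearD mulrDr Ex Ex'.
Qed.

End GroupAlgebra.

Section AlgebraQuotient.
Local Open Scope ring_scope.
Local Open Scope quotient_scope.
Variables (K : comNzRingType) (A : algType K) (S : A -> Prop).

Inductive ideal_gen : A -> Prop :=
| IdealGen x : S x -> ideal_gen x
| Ideal0 : ideal_gen 0
| IdealB x y : ideal_gen x -> ideal_gen y -> ideal_gen (x - y)
| IdealMl a x : ideal_gen x -> ideal_gen (a * x)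
| IdealMr a x : ideal_gen x -> ideal_gen (x * a).

Definition ideal_pred : {pred A} := fun x => `[< ideal_gen x >].

Lemma ideal_predP x : reflect (ideal_gen x) (x \in ideal_pred).
Proof. exact: asboolP. Qed.

Lemma ideal_pred_zmod_closed : zmod_closed ideal_pred.
Proof.
split; first exact/ideal_predP/Ideal0.
by move=> x y /ideal_predP ? /ideal_predP ?; apply/ideal_predP/IdealB.
Qed.
HB.instance Definition _ := GRing.isZmodClosed.Build A ideal_pred
  ideal_pred_zmod_closed.

Definition alg_quot : Type := Quotient.quot ideal_pred.
HB.instance Definition _ := GRing.Zmodule.on alg_quot.
HB.instance Definition _ := EqQuotient.on alg_quot.

Definition aq_pi (x : A) : alg_quot := \pi_alg_quot x.

Lemma aq_piP x y : aq_pi x = aq_pi y <-> ideal_gen (x - y).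
Proof.
split=> [E|/ideal_predP]; last by rewrite Quotient.idealrBE => /eqP.
by apply/ideal_predP; rewrite Quotient.idealrBE; apply/eqP.
Qed.

Lemma aq_pi_repr (x : alg_quot) : aq_pi (repr x) = x.
Proof. exact: reprK. Qed.

Lemma repr_aq_pi x : ideal_gen (repr (aq_pi x) - x).
Proof. by apply/aq_piP; rewrite aq_pi_repr. Qed.

Definition aq_one : alg_quot := aq_pi 1.
Fact aq_key : unit. Proof. exact: tt. Qed.
Definition aq_mul : alg_quot -> alg_quot -> alg_quot :=
  locked_with aq_key (fun x y => aq_pi (repr x * repr y)).
Definition aq_scale : K -> alg_quot -> alg_quot :=
  locked_with aq_key (fun c x => aq_pi (c *: repr x)).

Lemma idealD x y : ideal_gen x -> ideal_gen y -> ideal_gen (x + y).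
Proof.
by move=> /ideal_predP Ix /ideal_predP Iy; apply/ideal_predP/rpredD.
Qed.

Lemma idealZ c x : ideal_gen x -> ideal_gen (c *: x).
Proof. by move=> Ix; rewrite -[x]mul1r scalerAl; apply: IdealMl. Qed.

Lemma aq_mul_pi x y : aq_mul (aq_pi x) (aq_pi y) = aq_pi (x * y).
Proof.
rewrite /aq_mul unlock; apply/aq_piP; set x' := repr _; set y' := repr _.
have -> : x' * y' - x * y = (x' - x) * y' + x * (y' - y).
  by rewrite mulrBl mulrBr addrA subrK.
by apply: idealD; [apply: IdealMr|apply: IdealMl]; apply: repr_aq_pi.
Qed.

Lemma aq_scale_pi c x : aq_scale c (aq_pi x) = aq_pi (c *: x).
Proof. by rewrite /aq_scale unlock; apply/aq_piP; rewrite -scalerBr; apply/idealZ/repr_aq_pi. Qed.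

Lemma aq_piD : {morph aq_pi : x y / x + y}.
Proof. exact: Quotient.pi_add. Qed.

Lemma aq_mulA : associative aq_mul.
Proof.
move=> x y z; rewrite -[x]aq_pi_repr -[y]aq_pi_repr -[z]aq_pi_repr.
by rewrite !aq_mul_pi mulrA.
Qed.
Lemma aq_mul1l : left_id aq_one aq_mul.
Proof. by move=> x; rewrite -[x]aq_pi_repr aq_mul_pi mul1r. Qed.
Lemma aq_mul1r : right_id aq_one aq_mul.
Proof. by move=> x; rewrite -[x]aq_pi_repr aq_mul_pi mulr1. Qed.
Lemma aq_mulDl : left_distributive aq_mul +%R.
Proof.
move=> x y z; rewrite -[x]aq_pi_repr -[y]aq_pi_repr -[z]aq_pi_repr.
by rewrite -aq_piD !aq_mul_pi mulrDl aq_piD.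
Qed.
Lemma aq_mulDr : right_distributive aq_mul +%R.
Proof.
move=> x y z; rewrite -[x]aq_pi_repr -[y]aq_pi_repr -[z]aq_pi_repr.
by rewrite -aq_piD !aq_mul_pi mulrDr aq_piD.
Qed.

(* The quotient may be the zero ring for some S, hence a pzRingType. *)
HB.instance Definition _ := GRing.Zmodule_isPzRing.Build alg_quot
  aq_mulA aq_mul1l aq_mul1r aq_mulDl aq_mulDr.

Lemma aq_scaleA a b x : aq_scale a (aq_scale b x) = aq_scale (a * b) x.
Proof. by rewrite -[x]aq_pi_repr !aq_scale_pi scalerA. Qed.
Lemma aq_scale1 : left_id 1 aq_scale.
Proof. by move=> x; rewrite -[x]aq_pi_repr aq_scale_pi scale1r. Qed.
Lemma aq_scaleDr : right_distributive aq_scale +%R.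
Proof.
move=> c x y; rewrite -[x]aq_pi_repr -[y]aq_pi_repr.
by rewrite -aq_piD !aq_scale_pi scalerDr aq_piD.
Qed.
Lemma aq_scaleDl x : {morph aq_scale^~ x : a b / a + b}.
Proof.
by move=> a b; rewrite -[x]aq_pi_repr !aq_scale_pi scalerDl aq_piD.
Qed.

HB.instance Definition _ := GRing.Zmodule_isLmodule.Build K alg_quot
  aq_scaleA aq_scale1 aq_scaleDr aq_scaleDl.

Lemma aq_piM : {morph aq_pi : x y / x * y}.
Proof. by move=> x y; rewrite -aq_mul_pi. Qed.
Lemma aq_pi1 : aq_pi 1 = 1.
Proof. by []. Qed.
Lemma aq_piZ c x : aq_pi (c *: x) = c *: aq_pi x.
Proof. by rewrite -aq_scale_pi. Qed.

Lemma aq_pi_is_linear : linear aq_pi.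
Proof. by move=> c x y; rewrite aq_piD aq_piZ. Qed.
HB.instance Definition _ := GRing.isLinear.Build K A alg_quot *:%R aq_pi
  aq_pi_is_linear.

Lemma aq_scaleAl c (x y : alg_quot) : c *: (x * y) = c *: x * y.
Proof.
rewrite -[x]aq_pi_repr -[y]aq_pi_repr -aq_piM -!aq_piZ -aq_piM.
by rewrite scalerAl.
Qed.
Lemma aq_scaleAr c (x y : alg_quot) : c *: (x * y) = x * (c *: y).
Proof.
rewrite -[x]aq_pi_repr -[y]aq_pi_repr -aq_piM -!aq_piZ -aq_piM.
by rewrite scalerAr.
Qed.

End AlgebraQuotient.

(* The map induced on quotients by a linear f, through a chosen
   representative; [aq_map_pi] shows that the choice is irrelevant as soon as f
   preserves the ideals. *)
Definition aq_map (K : comNzRingType) (A B : algType K) (S : A -> Prop)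
    (T : B -> Prop) (f : {linear A -> B}) (x : alg_quot S) : alg_quot T :=
  aq_pi T (f (repr x)).

Lemma aq_map_pi (K : comNzRingType) (A B : algType K) (S : A -> Prop)
    (T : B -> Prop) (f : {linear A -> B}) x :
  (forall y, ideal_gen S y -> ideal_gen T (f y)) ->
  aq_map T f (aq_pi S x) = aq_pi T (f x).
Proof. by move=> fI; apply/aq_piP; rewrite -linearB; apply/fI/repr_aq_pi. Qed.

Section FramedBraids.

(* Everything is indexed from 0: [inl i] is the braid generator usually written
   sigma_{i+1} and [inr j] the framing generator t_{j+1}. *)
Definition fb_index (n : nat) : Type := ('I_n.-1 + 'I_n)%type.
HB.instance Definition _ n := Choice.on (fb_index n).

Section Relations.
Variable n : nat.

Lemma strand_subproof (i : 'I_n.-1) : i.+1 < n.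
Proof. by have := ltn_ord i; case: n i => [|m] i //; case: i. Qed.

(* The two strands, numbered i and i + 1, that cross in [inl i]. *)
Definition strandl (i : 'I_n.-1) : 'I_n := widen_ord (leq_pred n) i.
Definition strandr (i : 'I_n.-1) : 'I_n := Ordinal (strand_subproof i).

Definition wsigma (i : 'I_n.-1) : word (fb_index n) := letter (inl i : fb_index n).
Definition wt (j : 'I_n) : word (fb_index n) := letter (inr j : fb_index n).

Inductive fb_rel : word (fb_index n) -> word (fb_index n) -> Prop :=
| FB_braid (i j : 'I_n.-1) : (i.+1 == j) || (j.+1 == i) ->
    fb_rel (wsigma i ++ wsigma j ++ wsigma i) (wsigma j ++ wsigma i ++ wsigma j)
| FB_far (i j : 'I_n.-1) : (i.+1 < j) || (j.+1 < i) ->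
    fb_rel (wsigma i ++ wsigma j) (wsigma j ++ wsigma i)
| FB_framing i j : fb_rel (wt i ++ wt j) (wt j ++ wt i)
| FB_mixed i j :
    fb_rel (wt j ++ wsigma i) (wsigma i ++ wt (tperm (strandl i) (strandr i) j)).

Inductive mfb_rel (d : nat) : word (fb_index n) -> word (fb_index n) -> Prop :=
| MFB_framed u v : fb_rel u v -> mfb_rel d u v
| MFB_torsion j : mfb_rel d (flatten (nseq d (wt j))) [::].

End Relations.

Definition framed_braid (n : nat) : groupType := pres_group (@fb_rel n).

Definition mod_framed_braid (d n : nat) : groupType := pres_group (@mfb_rel n d).

Definition mfb_sigma (d n : nat) (i : 'I_n.-1) : mod_framed_braid d n :=
  pres_gen (@mfb_rel n d) (inl i).
Definition mfb_t (d n : nat) (j : 'I_n) : mod_framed_braid d n :=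
  pres_gen (@mfb_rel n d) (inr j).

Definition fb_reduce (d n : nat) : framed_braid n -> mod_framed_braid d n :=
  pres_lift (R := @fb_rel n) (pres_gen (@mfb_rel n d)).

Definition fb_widen (n : nat) (x : fb_index n) : fb_index n.+1 :=
  match x with
  | inl i => inl (widen_ord (leq_pred n) i)
  | inr j => inr (widen_ord (leqnSn n) j)
  end.

Definition mfb_incl (d n : nat) : mod_framed_braid d n -> mod_framed_braid d n.+1 :=
  pres_lift (R := @mfb_rel n d) (fun x => pres_gen (@mfb_rel n.+1 d) (fb_widen x)).

(* Reversal is defined on every representing word; it agrees with reading the
   normal form t_1^k_1 ... t_n^k_n sigma_{i_1}^l_1 ... sigma_{i_r}^l_r from
   right to left. *)
Definition fb_rev (n : nat) : framed_braid n -> framed_braid n :=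
  @pres_rev _ (@fb_rel n).
Definition mfb_rev (d n : nat) : mod_framed_braid d n -> mod_framed_braid d n :=
  @pres_rev _ (@mfb_rel n d).

Local Open Scope group_scope.

Lemma fb_rev_rel n u v : fb_rel u v -> word_eq (@fb_rel n) (rev u) (rev v).
Proof.
case=> [i j H|i j H|i j|i j].
- exact/WordRel/FB_braid.
- by apply/WordSym/WordRel/FB_far.
- by apply/WordSym/WordRel/FB_framing.
- rewrite !rev_cat; apply/WordSym.
  rewrite -{2}[j](tpermK (strandl i) (strandr i)).
  exact/WordRel/FB_mixed.
Qed.

Lemma mfb_rev_rel d n u v :
  mfb_rel d u v -> word_eq (@mfb_rel n d) (rev u) (rev v).
Proof.
case=> [{}u {}v /fb_rev_rel|j].
  elim=> {u v}.
  - by move=> u v H; apply/WordRel/MFB_framed.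
  - exact: WordCancel.
  - by move=> u u' v v' _ Hu _ Hv; apply: WordCat.
  - exact: WordRefl.
  - by move=> u v _; apply: WordSym.
  - by move=> v u w _ H1 _ H2; apply: WordTrans H1 H2.
suff -> : rev (flatten (nseq d (wt j))) = flatten (nseq d (wt j)).
  exact/WordRel/MFB_torsion.
have -> : flatten (nseq d (wt j)) = nseq d (inr j, false).
  by elim: d => //= d ->.
by apply: (@eq_from_nth _ (inr j, false)) => [|k];
  rewrite size_rev ?size_nseq // => kd; rewrite nth_rev ?size_nseq // !nth_nseq !if_same.
Qed.

Lemma fb_reduce_rel d n u v : fb_rel u v ->
  word_eval (pres_gen (@mfb_rel n d)) u = word_eval (pres_gen (@mfb_rel n d)) v.
Proof.
by move=> H; rewrite -!pres_pi_eval; apply/pres_piP/WordRel/MFB_framed.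
Qed.

Lemma fb_reduceM d n : {morph @fb_reduce d n : x y / x * y}.
Proof. exact/pres_liftM/fb_reduce_rel. Qed.

Lemma fb_reduce_gen d n x :
  fb_reduce d (pres_gen (@fb_rel n) x) = pres_gen (@mfb_rel n d) x.
Proof.
by rewrite /fb_reduce pres_lift_pi; [rewrite /= mulg1 | apply: fb_reduce_rel].
Qed.

Lemma fb_reduce_rev d n (x : framed_braid n) :
  fb_reduce d (fb_rev x) = mfb_rev (fb_reduce d x).
Proof.
rewrite -[x]pres_pi_repr /fb_rev pres_rev_pi; last exact: fb_rev_rel.
rewrite /fb_reduce !pres_lift_pi; try exact: fb_reduce_rel.
by rewrite -!pres_pi_eval /mfb_rev pres_rev_pi //; apply: mfb_rev_rel.
Qed.

Lemma mfb_revM d n : {morph @mfb_rev d n : x y / x * y >-> y * x}.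
Proof. exact/pres_revM/mfb_rev_rel. Qed.

Lemma mfb_rev_gen d n x :
  mfb_rev (pres_gen (@mfb_rel n d) x) = pres_gen (@mfb_rel n d) x.
Proof. by rewrite /mfb_rev pres_rev_pi //; apply: mfb_rev_rel. Qed.

Lemma mfb_rev1 d n : mfb_rev (1 : mod_framed_braid d n) = 1.
Proof. by rewrite /mfb_rev -pres_pi1 pres_rev_pi //; apply: mfb_rev_rel. Qed.

Lemma mfb_revV d n (x : mod_framed_braid d n) : mfb_rev x^-1 = (mfb_rev x)^-1.
Proof.
apply: (mulgI (mfb_rev x)); rewrite mulgV -mfb_revM mulVg; exact: mfb_rev1.
Qed.

Lemma mfb_revX d n (x : mod_framed_braid d n) k : mfb_rev (x ^+ k) = mfb_rev x ^+ k.
Proof.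
by elim: k => [|k IH]; rewrite ?expg0 ?mfb_rev1 // expgS mfb_revM IH -expgSr.
Qed.

Definition wwiden n (w : word (fb_index n)) : word (fb_index n.+1) :=
  [seq (fb_widen x.1, x.2) | x <- w].

Lemma fb_widen_rel n u v : fb_rel u v -> @fb_rel n.+1 (wwiden u) (wwiden v).
Proof.
case=> [i j H|i j H|i j|i j].
- exact: FB_braid.
- exact: FB_far.
- exact: FB_framing.
- have := FB_mixed (widen_ord (leq_pred n) i : 'I_n.+1.-1) (widen_ord (leqnSn n) j).
  rewrite /wwiden /= /wt /letter /=.
  suff -> : widen_ord (leqnSn n) (tperm (strandl i) (strandr i) j) =
    tperm (strandl (widen_ord (leq_pred n) i : 'I_n.+1.-1))
          (strandr (widen_ord (leq_pred n) i : 'I_n.+1.-1)) (widen_ord (leqnSn n) j).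
    by [].
  have wI : injective (widen_ord (leqnSn n)).
    by move=> a b /(congr1 val) /= /val_inj.
  have El : widen_ord (leqnSn n) (strandl i) =
    strandl (widen_ord (leq_pred n) i : 'I_n.+1.-1) by exact: val_inj.
  have Er : widen_ord (leqnSn n) (strandr i) =
    strandr (widen_ord (leq_pred n) i : 'I_n.+1.-1) by exact: val_inj.
  rewrite -El -Er.
  by case: tpermP => [->|->|/eqP n1 /eqP n2]; rewrite ?tpermL ?tpermR //
    tpermD // (inj_eq wI) eq_sym.
Qed.

Lemma mfb_incl_eval d n w :
  word_eval (fun x => pres_gen (@mfb_rel n.+1 d) (fb_widen x)) w =
  pres_pi (@mfb_rel n.+1 d) (wwiden w).
Proof. by rewrite pres_pi_eval; elim: w => [|x w IH] //=; rewrite IH. Qed.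

Lemma mfb_incl_rel d n u v : @mfb_rel n d u v ->
  word_eval (fun x => pres_gen (@mfb_rel n.+1 d) (fb_widen x)) u =
  word_eval (fun x => pres_gen (@mfb_rel n.+1 d) (fb_widen x)) v.
Proof.
rewrite !mfb_incl_eval => H; apply/pres_piP/WordRel.
case: H => [{}u {}v /fb_widen_rel|j]; first exact: MFB_framed.
suff -> : wwiden (flatten (nseq d (wt j))) =
  flatten (nseq d (wt (widen_ord (leqnSn n) j))) by exact: MFB_torsion.
by elim: d => //= d ->.
Qed.

Lemma mfb_inclM d n : {morph @mfb_incl d n : x y / x * y}.
Proof. exact/pres_liftM/mfb_incl_rel. Qed.

Lemma mfb_incl_gen d n x :
  mfb_incl (pres_gen (@mfb_rel n d) x) = pres_gen (@mfb_rel n.+1 d) (fb_widen x).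
Proof.
by rewrite /mfb_incl pres_lift_pi; [rewrite /= mulg1 | apply: mfb_incl_rel].
Qed.

Lemma mfb_incl1 d n : mfb_incl (1 : mod_framed_braid d n) = 1.
Proof. by rewrite /mfb_incl -pres_pi1 pres_lift_pi //; apply: mfb_incl_rel. Qed.

Lemma mfb_inclV d n (x : mod_framed_braid d n) : mfb_incl x^-1 = (mfb_incl x)^-1.
Proof.
by apply: (mulgI (mfb_incl x)); rewrite mulgV -mfb_inclM mulgV mfb_incl1.
Qed.

Lemma mfb_inclX d n (x : mod_framed_braid d n) k :
  mfb_incl (x ^+ k) = mfb_incl x ^+ k.
Proof. by elim: k => [|k IH]; rewrite ?mfb_incl1 // !expgS mfb_inclM IH. Qed.

Lemma mfb_tC d n i j : commute (@mfb_t d n i) (mfb_t d j).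
Proof.
by rewrite /commute /mfb_t /pres_gen -!pres_piM; apply/pres_piP/WordRel/MFB_framed/FB_framing.
Qed.

End FramedBraids.

Import mpoly.

Section YokonumaHecke.
Local Open Scope ring_scope.
Variables (K : fieldType) (q : K) (d : nat).

Section FixedStrands.
Variable n : nat.

Local Notation KF := (galg K (mod_framed_braid d n)).

Definition yh_e (i : 'I_n.-1) : KF :=
  d%:R^-1 *: \sum_(1 <= s < d.+1)
    gelt K (mfb_t d (strandl i) ^+ s * mfb_t d (strandr i) ^- s)%g.

Definition yh_rel (x : KF) : Prop :=
  exists i : 'I_n.-1, let sigma := gelt K (mfb_sigma d i) in
    x = sigma ^+ 2 - 1 - (q - q^-1) *: (yh_e i * sigma).

Definition yokonuma_hecke : Type := alg_quot yh_rel.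
HB.instance Definition _ := GRing.PzRing.on yokonuma_hecke.
HB.instance Definition _ := GRing.Lmodule.on yokonuma_hecke.

Definition yh_of_group (x : mod_framed_braid d n) : yokonuma_hecke :=
  aq_pi yh_rel (gelt K x).
Definition yh_g (i : 'I_n.-1) : yokonuma_hecke := yh_of_group (mfb_sigma d i).
Definition yh_t (j : 'I_n) : yokonuma_hecke := yh_of_group (mfb_t d j).

Definition yh_of_braid (alpha : framed_braid n) : yokonuma_hecke :=
  yh_of_group (fb_reduce d alpha).

Definition yh_rev (a : yokonuma_hecke) : yokonuma_hecke :=
  aq_map yh_rel (galg_map K (@mfb_rev d n)) a.

End FixedStrands.

Definition yh_incl (n : nat) (a : yokonuma_hecke n) : yokonuma_hecke n.+1 :=
  aq_map (@yh_rel n.+1) (galg_map K (@mfb_incl d n)) a.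

Section InducedMaps.
Variable n : nat.
Local Notation KF := (galg K (mod_framed_braid d n)).

Lemma ideal_gen_map (A B : algType K) (S : A -> Prop) (T : B -> Prop)
    (f : {linear A -> B}) :
  (forall x, S x -> ideal_gen T (f x)) ->
  {morph f : x y / x * y} \/ {morph f : x y / x * y >-> y * x} ->
  forall x, ideal_gen S x -> ideal_gen T (f x).
Proof.
move=> fS fM x; elim=> {x} [x /fS //||x y _ Hx _ Hy|a x _ Hx|a x _ Hx].
- rewrite linear0; exact: Ideal0.
- by rewrite linearB; apply: IdealB.
- by case: fM => ->; [apply: IdealMl|apply: IdealMr].
- by case: fM => ->; [apply: IdealMr|apply: IdealMl].
Qed.

Lemma yh_rev_gelt (x : mod_framed_braid d n) :
  galg_map K (@mfb_rev d n) (gelt K x) = gelt K (mfb_rev x).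
Proof. exact: galg_map_gelt. Qed.

Lemma yh_e_rev i : galg_map K (@mfb_rev d n) (yh_e i) = yh_e i.
Proof.
rewrite /yh_e linearZ linear_sum; congr (_ *: _); apply: eq_bigr => s _.
rewrite yh_rev_gelt mfb_revM mfb_revV !mfb_revX !mfb_rev_gen; congr (gelt K _).
by apply/esym/commuteV/commuteX2/mfb_tC.
Qed.

Lemma quadratic_conj (A : algType K) (c : K) (s e s' : A) : s * s' = 1 ->
  s * s - 1 - c *: (s * e) = s * (s ^+ 2 - 1 - c *: (e * s)) * s'.
Proof.
move=> ss'; rewrite expr2 !mulrBr !mulrBl mulr1 ss' -scalerAr -scalerAl.
by rewrite -!mulrA ss' !mulr1.
Qed.

Lemma yh_rev_ideal (x : KF) : ideal_gen (@yh_rel n) x ->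
  ideal_gen (@yh_rel n) (galg_map K (@mfb_rev d n) x).
Proof.
have revM := galg_mapM_rev (K := K) (@mfb_revM d n).
apply: ideal_gen_map; last by right.
move=> _ [i ->] /=; set sigma := gelt K _.
have -> : galg_map K (@mfb_rev d n)
      (sigma ^+ 2 - 1 - (q - q^-1) *: (yh_e i * sigma)) =
    sigma * (sigma ^+ 2 - 1 - (q - q^-1) *: (yh_e i * sigma)) *
      gelt K (mfb_sigma d i)^-1%g.
  have Es : galg_map K (@mfb_rev d n) sigma = sigma.
    by rewrite yh_rev_gelt mfb_rev_gen.
  have E1 : galg_map K (@mfb_rev d n) 1 = 1.
    by rewrite -(gelt1 K (mod_framed_braid d n)) yh_rev_gelt mfb_rev1.
  have sV : sigma * gelt K (mfb_sigma d i)^-1%g = 1 by rewrite -geltM mulgV gelt1.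
  rewrite !linearB linearZ expr2 !revM Es E1 yh_e_rev /=.
  exact: quadratic_conj sV.
by apply/IdealMr/IdealMl/IdealGen; exists i.
Qed.

Lemma yh_rev_pi (x : KF) :
  yh_rev (aq_pi (@yh_rel n) x) = aq_pi (@yh_rel n) (galg_map K (@mfb_rev d n) x).
Proof. exact/aq_map_pi/yh_rev_ideal. Qed.

Lemma yh_rev_group (x : mod_framed_braid d n) :
  yh_rev (yh_of_group x) = yh_of_group (mfb_rev x).
Proof. by rewrite /yh_of_group yh_rev_pi yh_rev_gelt. Qed.

Lemma yh_rev_g i : yh_rev (@yh_g n i) = yh_g i.
Proof. by rewrite /yh_g yh_rev_group mfb_rev_gen. Qed.

Lemma yh_rev_t j : yh_rev (@yh_t n j) = yh_t j.
Proof. by rewrite /yh_t yh_rev_group mfb_rev_gen. Qed.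

Lemma yh_rev_is_linear : linear (@yh_rev n).
Proof.
move=> c x y; rewrite -[x]aq_pi_repr -[y]aq_pi_repr.
by rewrite -[c *: _]aq_piZ -aq_piD !yh_rev_pi linearP aq_piD aq_piZ.
Qed.

Lemma yh_revM : {morph @yh_rev n : x y / x * y >-> y * x}.
Proof.
move=> x y; rewrite -[x]aq_pi_repr -[y]aq_pi_repr.
rewrite -[_ * _]aq_piM !yh_rev_pi galg_mapM_rev ?aq_piM //; exact: mfb_revM.
Qed.

Lemma yh_rev1 : yh_rev (1 : yokonuma_hecke n) = 1.
Proof.
by rewrite -[1](aq_pi1 (@yh_rel n)) yh_rev_pi -gelt1 yh_rev_gelt mfb_rev1.
Qed.

Lemma yh_e_incl i : galg_map K (@mfb_incl d n) (yh_e i) =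
  yh_e (widen_ord (leq_pred n) i : 'I_n.+1.-1).
Proof.
rewrite /yh_e linearZ linear_sum; congr (_ *: _); apply: eq_bigr => s _.
rewrite galg_map_gelt mfb_inclM mfb_inclV !mfb_inclX !mfb_incl_gen.
by congr (gelt K (pres_gen _ (inr _) ^+ s * (pres_gen _ (inr _) ^+ s)^-1)%g);
  apply: val_inj.
Qed.

Lemma yh_incl_ideal (x : KF) : ideal_gen (@yh_rel n) x ->
  ideal_gen (@yh_rel n.+1) (galg_map K (@mfb_incl d n) x).
Proof.
have inclM := galg_mapM (K := K) (@mfb_inclM d n).
apply: ideal_gen_map; last by left.
move=> _ [i ->] /=; apply: IdealGen; exists (widen_ord (leq_pred n) i) => /=.
have E1 : galg_map K (@mfb_incl d n) 1 = 1.
  by rewrite -(gelt1 K (mod_framed_braid d n)) galg_map_gelt mfb_incl1 gelt1.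
have Es : galg_map K (@mfb_incl d n) (gelt K (mfb_sigma d i)) =
    gelt K (mfb_sigma d (widen_ord (leq_pred n) i : 'I_n.+1.-1)).
  by rewrite galg_map_gelt mfb_incl_gen.
by rewrite !linearB linearZ !expr2 !inclM E1 Es yh_e_incl.
Qed.

Lemma yh_incl_pi (x : KF) : yh_incl (aq_pi (@yh_rel n) x) =
  aq_pi (@yh_rel n.+1) (galg_map K (@mfb_incl d n) x).
Proof. exact/aq_map_pi/yh_incl_ideal. Qed.

Lemma yh_incl_group (x : mod_framed_braid d n) :
  yh_incl (yh_of_group x) = yh_of_group (mfb_incl x).
Proof. by rewrite /yh_of_group yh_incl_pi galg_map_gelt. Qed.

Lemma yh_incl_g i :
  yh_incl (@yh_g n i) = yh_g (n := n.+1) (widen_ord (leq_pred n) i).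
Proof. by rewrite /yh_g yh_incl_group mfb_incl_gen. Qed.

Lemma yh_incl_t j :
  yh_incl (@yh_t n j) = yh_t (n := n.+1) (widen_ord (leqnSn n) j).
Proof. by rewrite /yh_t yh_incl_group mfb_incl_gen. Qed.

Lemma yh_incl_is_linear : linear (@yh_incl n).
Proof.
move=> c x y; rewrite -[x]aq_pi_repr -[y]aq_pi_repr.
by rewrite -[c *: _]aq_piZ -aq_piD !yh_incl_pi linearP aq_piD aq_piZ.
Qed.

Lemma yh_inclM : {morph @yh_incl n : x y / x * y}.
Proof.
move=> x y; rewrite -[x]aq_pi_repr -[y]aq_pi_repr.
rewrite -[_ * _]aq_piM !yh_incl_pi galg_mapM ?aq_piM //; exact: mfb_inclM.
Qed.

Lemma yh_of_groupM :
  {morph @yh_of_group n : x y / (x * y)%g >-> x * y}.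
Proof. by move=> x y; rewrite /yh_of_group geltM aq_piM. Qed.

Lemma yh_g_sqr i : (@yh_g n i) ^+ 2 =
  1 + (q - q^-1) *: (aq_pi (@yh_rel n) (yh_e i) * yh_g i).
Proof.
rewrite expr2 -[yh_g i * yh_g i]aq_piM -[_ * yh_g i]aq_piM -[_ *: _]aq_piZ.
rewrite -(aq_pi1 (@yh_rel n)) -aq_piD; apply/aq_piP.
by rewrite opprD addrA -expr2; apply: IdealGen; exists i.
Qed.

End InducedMaps.

(* A linear map on the union of the tower is a family of linear maps compatible
   with the inclusions. In K[X_0, ..., X_{d-1}], the variable X_0 is z and X_s
   is x_s for 0 < s. *)
Record juyumaya_trace (d_gt0 : (0 < d)%N)
    (tr : forall n, {linear yokonuma_hecke n -> {mpoly K[d]}}) : Prop := {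
  juyumaya_incl : forall n a, tr n.+1 (yh_incl a) = tr n a;
  juyumaya_comm : forall n (a b : yokonuma_hecke n), tr n (a * b) = tr n (b * a);
  juyumaya_one : forall n, tr n 1 = 1;
  juyumaya_g : forall n (a : yokonuma_hecke n.+1),
    tr n.+2 (yh_incl a * yh_g (n := n.+2) ord_max) =
      'X_(Ordinal d_gt0) * tr n.+1 a;
  juyumaya_t : forall n (a : yokonuma_hecke n) (s : 'I_d), (0 < s)%N ->
    tr n.+1 (yh_incl a * yh_t (n := n.+1) ord_max ^+ s) = 'X_s * tr n a
}.

End YokonumaHecke.

(* Main.v *)
Require Import Defs.
From HB Require Import structures.
From mathcomp Require Import all_boot all_order all_fingroup all_algebra.
From mathcomp Require Import reals complex mpoly.

(** Reversal fixes the generators and swaps the factors of a product, while the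
trace does not see the order of two factors; what makes this enough is that, up
to linear combinations, an element of the algebra on n + 1 strands contains the
last new generator in a single place.  Write Y_n for the algebra on n strands,
g for the last braid generator of Y_(n+1) and t for its last framing generator.
Then Y_(n+1) is spanned by the elements a t^s and a g b, with a and b in Y_n
([tower_spanT]).  Hence the identity tr (rev x) = tr x follows by induction on
the number of strands ([tr_rev]):
- for x = a g b, both tr x = tr (b a g) = z tr (b a) and
  tr (rev x) = tr (rev b g rev a) = z tr (rev a rev b) = z tr (rev (b a)), and
  b a lies in Y_n;
- for x = a t^s with 0 < s < d, rev x = t^s (rev a) = (rev a) t^s because t
  commutes with Y_n, so tr x = x_s tr a and tr (rev x) = x_s tr (rev a); the
  case s = 0 is the induction hypothesis itself.
On Y_0, the scalars, reversal is the identity.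

The spanning statement is the inductive basis argument without linear
independence.  One checks that the span is stable under left multiplication by
the generators; all the content is in g (a g b) ([lstable_glast]), where a in Y_n
may be taken by induction of the form a' t'^s or a' g' a'', with a' and a'' two
levels below g and hence commuting with it.  In the first case the two factors g
meet and the quadratic relation applies; in the second the braid relation
g g' g = g' g g' leaves a single g.  Inverses of generators need no separate
treatment, since t^-1 = t^(d-1) and g^-1 is a combination of g and powers of
the framing generators ([yh_ind]).

The statement on framed braids is the one on algebra elements, applied to the
image of the braid. *)

Set Implicit Arguments.
Unset Strict Implicit.
Unset Printing Implicit Defensive.

Local Open Scope ring_scope.
Import GRing.Theory.

(** * Relations between the generators *)

Section Relations.
Variables (K : fieldType) (q : K) (d n : nat).
Local Notation Y := (yokonuma_hecke q d n).
Local Notation grp := (@yh_of_group K q d n).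
Local Notation g := (@yh_g K q d n).
Local Notation t := (@yh_t K q d n).

Lemma yh_of_group1 : grp 1%g = 1.
Proof. by rewrite /yh_of_group gelt1 aq_pi1. Qed.

Lemma yh_of_groupX x k : grp (x ^+ k)%g = grp x ^+ k.
Proof.
elim: k => [|k IH]; first by rewrite expg0 yh_of_group1 expr0.
by rewrite expgS yh_of_groupM IH exprS.
Qed.

Lemma yh_of_word_eq u v : word_eq (@mfb_rel n d) u v ->
  grp (pres_pi _ u) = grp (pres_pi _ v).
Proof. by move=> /pres_piP ->. Qed.

Lemma yh_tC i j : t i * t j = t j * t i.
Proof. by rewrite -!yh_of_groupM mfb_tC. Qed.

Lemma yh_tg i j : t j * g i = g i * t (tperm (strandl i) (strandr i) j).
Proof.
rewrite -!yh_of_groupM -!pres_piM.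
exact/yh_of_word_eq/WordRel/MFB_framed/FB_mixed.
Qed.

Lemma yh_tgl i : t (strandl i) * g i = g i * t (strandr i).
Proof. by rewrite yh_tg tpermL. Qed.

Lemma yh_tgr i : t (strandr i) * g i = g i * t (strandl i).
Proof. by rewrite yh_tg tpermR. Qed.

Lemma yh_tgC (i : 'I_n.-1) (j : 'I_n) :
  j != i :> nat -> j != i.+1 :> nat -> t j * g i = g i * t j.
Proof.
move=> nl nr; rewrite yh_tg tpermD //; apply/eqP => E; move: nl nr.
  by rewrite -E eqxx.
by rewrite -E /= eqxx.
Qed.

Lemma yh_gC (i j : 'I_n.-1) : (i.+1 < j)%N -> g i * g j = g j * g i.
Proof.
move=> ij; rewrite -!yh_of_groupM -!pres_piM.
by apply/yh_of_word_eq/WordRel/MFB_framed/FB_far; rewrite ij.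
Qed.

Lemma yh_braid (i j : 'I_n.-1) : i.+1 = j ->
  g j * g i * g j = g i * g j * g i.
Proof.
have gE (k l m : 'I_n.-1) : g k * g l * g m =
    grp (pres_pi _ (wsigma k ++ wsigma l ++ wsigma m)).
  by rewrite !pres_piM !yh_of_groupM mulrA.
move=> ij; rewrite !gE; apply/yh_of_word_eq/WordRel/MFB_framed.
by apply: (FB_braid (i := j) (j := i)); rewrite ij eqxx orbT.
Qed.

Lemma mfb_tX (j : 'I_n) : (mfb_t d j ^+ d = 1)%g.
Proof.
have H k : (mfb_t d j ^+ k)%g = pres_pi _ (flatten (nseq k (wt j))).
  by elim: k => [|k IH]; rewrite ?expg0 // expgS IH -pres_piM.
by rewrite H; apply/pres_piP/WordRel/MFB_torsion.
Qed.

Lemma yh_tX j : t j ^+ d = 1.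
Proof. by rewrite -yh_of_groupX mfb_tX yh_of_group1. Qed.

Lemma yh_tX_mod j s : t j ^+ s = t j ^+ (s %% d).
Proof. by rewrite {1}(divn_eq s d) exprD mulnC exprM yh_tX expr1n mul1r. Qed.

(** The quadratic relation g^2 = 1 + (q - q^-1) e g, multiplied by g^-1: the
inverse is a combination of g and e, which only involves framing generators. *)
Lemma yh_gV i : grp (mfb_sigma d i)^-1%g =
  g i - (q - q^-1) *: aq_pi _ (yh_e K d i).
Proof.
have gV : g i * grp (mfb_sigma d i)^-1%g = 1.
  by rewrite -yh_of_groupM mulgV yh_of_group1.
have := congr1 (fun x : Y => x * grp (mfb_sigma d i)^-1%g) (yh_g_sqr q d i).
rewrite /= expr2 mulrDl mul1r -aq_scaleAl -!mulrA gV !mulr1.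
by move=> ->; rewrite addrK.
Qed.

End Relations.

(** * Induction over products of generators *)

Section Induction.
Variables (K : fieldType) (q : K) (d n : nat).
Hypothesis d_gt0 : (0 < d)%N.
Local Notation Y := (yokonuma_hecke q d n).
Local Notation grp := (@yh_of_group K q d n).

Definition subspace (P : Y -> Prop) :=
  P 0 /\ forall c x y, P x -> P y -> P (c *: x + y).
Definition lstable (P : Y -> Prop) a := forall x, P x -> P (a * x).

Variable P : Y -> Prop.
Hypothesis Plin : subspace P.

Lemma subspaceD x y : P x -> P y -> P (x + y).
Proof. by move=> Px Py; rewrite -[x]scale1r; apply: Plin.2. Qed.

Lemma subspaceZ c x : P x -> P (c *: x).
Proof. by move=> Px; rewrite -[_ *: _]addr0; apply: Plin.2 Plin.1. Qed.

Lemma lstableM a b : lstable P a -> lstable P b -> lstable P (a * b).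
Proof. by move=> Ha Hb x Px; rewrite -mulrA; apply/Ha/Hb. Qed.

Lemma lstableD a b : lstable P a -> lstable P b -> lstable P (a + b).
Proof. by move=> Ha Hb x Px; rewrite mulrDl; apply: subspaceD; auto. Qed.

Lemma lstableZ c a : lstable P a -> lstable P (c *: a).
Proof. by move=> Ha x Px; rewrite -aq_scaleAl; apply/subspaceZ/Ha. Qed.

Lemma lstable0 : lstable P 0.
Proof. by move=> x _; rewrite mul0r; apply: Plin.1. Qed.

Lemma lstable1 : lstable P 1.
Proof. by move=> x Px; rewrite mul1r. Qed.

Lemma lstableX a k : lstable P a -> lstable P (a ^+ k).
Proof.
move=> Ha; elim: k => [|k IH]; first exact: lstable1.
by rewrite exprS; apply: lstableM.
Qed.

Lemma lstable_tV j : lstable P (yh_t q d j) ->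
  lstable P (grp (mfb_t d j)^-1%g).
Proof.
move=> Hj; suff -> : grp (mfb_t d j)^-1%g = yh_t q d j ^+ d.-1 by exact: lstableX.
rewrite -yh_of_groupX; congr (yh_of_group _ _).
by apply/(mulgI (mfb_t d j)); rewrite mulgV -expgS prednK // mfb_tX.
Qed.

Lemma lstable_e i : (forall j, lstable P (yh_t q d j)) ->
  lstable P (aq_pi (@yh_rel K q d n) (yh_e K d i)).
Proof.
move=> Ht; rewrite /yh_e aq_piZ linear_sum; apply: lstableZ.
apply: (big_ind (lstable P)) => [|a b|s _]; [exact: lstable0|exact: lstableD|].
rewrite /= -expVgn geltM aq_piM; apply: lstableM.
  by rewrite -/(yh_of_group q _) yh_of_groupX; apply/lstableX/Ht.
by rewrite -/(yh_of_group q _) yh_of_groupX; apply/lstableX/lstable_tV/Ht.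
Qed.

(** Inverses of generators are linear combinations of products of generators
([yh_gV], and t_j^-1 = t_j^(d-1)), so the generators alone have to be tested. *)
Lemma yh_ind : P 1 -> (forall i, lstable P (yh_g q d i)) ->
  (forall j, lstable P (yh_t q d j)) -> forall x, P x.
Proof.
move=> P1 Hg Ht x; rewrite -[x]aq_pi_repr.
elim/galg_ind: (generic_quotient.repr x) => [|c h|a b Pa Pb].
- by rewrite linear0; apply: Plin.1.
- rewrite aq_piZ; apply: subspaceZ; rewrite -[aq_pi _ _]mulr1.
  suff: lstable P (grp h) by apply.
  rewrite -[h]pres_pi_repr; elim: (generic_quotient.repr h) => [|[k b] w IH].
    by rewrite pres_pi1 yh_of_group1; apply: lstable1.
  rewrite -cat1s pres_piM yh_of_groupM; apply: lstableM IH.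
  case: b; last by case: k => k; [apply: Hg|apply: Ht].
  have -> : pres_pi (@mfb_rel n d) [:: (k, true)] = (pres_gen _ k)^-1%g.
    by rewrite -pres_piV.
  case: k => k; last exact/lstable_tV/Ht.
  rewrite -/(mfb_sigma d k) yh_gV -scaleNr; apply: lstableD; first exact: Hg.
  exact/lstableZ/lstable_e.
- by rewrite aq_piD; apply: subspaceD.
Qed.

End Induction.

(** * The spanning set of one level over the previous one *)

HB.instance Definition _ (K : fieldType) (q : K) (d n : nat) :=
  GRing.isLinear.Build K (yokonuma_hecke q d n) (yokonuma_hecke q d n.+1) *:%R
    (@yh_incl K q d n) (@yh_incl_is_linear K q d n).
HB.instance Definition _ (K : fieldType) (q : K) (d n : nat) :=
  GRing.isLinear.Build K (yokonuma_hecke q d n) (yokonuma_hecke q d n) *:%R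
    (@yh_rev K q d n) (@yh_rev_is_linear K q d n).

Lemma yh_incl1 (K : fieldType) (q : K) (d n : nat) :
  yh_incl (1 : yokonuma_hecke q d n) = 1.
Proof. by rewrite -yh_of_group1 yh_incl_group mfb_incl1 yh_of_group1. Qed.

Section Tower.
Variables (K : fieldType) (q : K) (d : nat).
Hypothesis d_gt0 : (0 < d)%N.
Local Notation Y n := (yokonuma_hecke q d n).
Local Notation incl := (@yh_incl K q d _).
Local Notation tlast n := (yh_t q d (n := n.+1) ord_max).
Local Notation glast n := (yh_g q d (n := n.+2) ord_max).

Lemma inclM n (a b : Y n) : incl (a * b) = incl a * incl b.
Proof. exact: yh_inclM. Qed.

Lemma commute_subspace n m (f : {linear Y n -> Y m}) b :
  subspace (fun a => f a * b = b * f a).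
Proof.
split=> [|c x y Ex Ey]; first by rewrite linear0 mul0r mulr0.
by rewrite linearP mulrDl mulrDr -aq_scaleAl -aq_scaleAr Ex Ey.
Qed.

Lemma commute_incl_tlast n (a : Y n) : incl a * tlast n = tlast n * incl a.
Proof.
elim/(@yh_ind K q d n d_gt0): a.
- exact: commute_subspace.
- by rewrite yh_incl1 mul1r mulr1.
- move=> i x Px; rewrite inclM -mulrA Px !mulrA yh_incl_g yh_tgC //=.
    by rewrite gtn_eqF // ltnW // strand_subproof.
  by rewrite gtn_eqF // strand_subproof.
- by move=> j x Px; rewrite inclM -mulrA Px !mulrA yh_incl_t yh_tC.
Qed.

Lemma commute_incl_glast n (a : Y n) :
  incl (incl a) * glast n = glast n * incl (incl a).
Proof.
elim/(@yh_ind K q d n d_gt0): a.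
- exact: (commute_subspace (incl \o incl)).
- by rewrite !yh_incl1 mul1r mulr1.
- move=> i x Px; rewrite !inclM -mulrA Px !mulrA !yh_incl_g yh_gC //=.
  exact: strand_subproof.
- move=> j x Px; rewrite !inclM -mulrA Px !mulrA !yh_incl_t yh_tgC //=.
    by rewrite ltn_eqF.
  by rewrite ltn_eqF // ltnS ltnW.
Qed.

(** The linear span of the elements a t^s and a g b; scalars are absorbed by a.
The equation on i makes it the last index while keeping the number of strands a
variable: on a single strand there is no g. *)
Inductive tower_span n : Y n.+1 -> Prop :=
| TowerT (a : Y n) s : tower_span (incl a * tlast n ^+ s)
| TowerG (i : 'I_n) (a b : Y n) : i.+1 = n ->
    tower_span (incl a * yh_g q d (n := n.+1) i * incl b)
| Tower0 : tower_span 0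
| TowerD x y : tower_span x -> tower_span y -> tower_span (x + y).

Lemma tower_span_subspace n : subspace (@tower_span n).
Proof.
split=> [|c x y Hx]; first exact: Tower0.
apply: TowerD; elim: Hx => {x y} [a s|i a b Hi||x y _ Hx _ Hy].
- by rewrite aq_scaleAl -linearZ; apply: TowerT.
- by rewrite !aq_scaleAl -linearZ; apply: TowerG.
- by rewrite scaler0; apply: Tower0.
- by rewrite scalerDr; apply: TowerD.
Qed.

Lemma lstable_tower_span n (a : Y n.+1) :
  (forall b s, tower_span (a * (incl b * tlast n ^+ s))) ->
  (forall (i : 'I_n) b c, i.+1 = n ->
    tower_span (a * (incl b * yh_g q d (n := n.+1) i * incl c))) ->
  lstable (@tower_span n) a.
Proof.
move=> Ht Hg x; elim=> {x} [b s|i b c|| x y _ Hx _ Hy] //.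
- exact: Hg.
- by rewrite mulr0; apply: Tower0.
- by rewrite mulrDr; apply: TowerD.
Qed.

Lemma lstable_incl n (a : Y n) : lstable (@tower_span n) (incl a).
Proof.
apply: lstable_tower_span => [b s|i b c Hi].
- by rewrite mulrA -inclM; apply: TowerT.
- by rewrite !mulrA -inclM; apply: TowerG.
Qed.

Lemma commute_incl_tlastX n (a : Y n) s :
  incl a * tlast n ^+ s = tlast n ^+ s * incl a.
Proof.
elim: s => [|s IH]; first by rewrite mulr1 mul1r.
by rewrite !exprS mulrA commute_incl_tlast -!mulrA IH.
Qed.

Lemma tlast_glast n : tlast n.+1 * glast n = glast n * incl (tlast n).
Proof.
have -> : tlast n.+1 = yh_t q d (strandr (ord_max : 'I_n.+2.-1)).
  by congr (yh_t _ _ _); apply: val_inj.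
by rewrite yh_tgr yh_incl_t; congr (_ * yh_t _ _ _); apply: val_inj.
Qed.

Lemma glast_tlast n : glast n * tlast n.+1 = incl (tlast n) * glast n.
Proof.
have -> : tlast n.+1 = yh_t q d (strandr (ord_max : 'I_n.+2.-1)).
  by congr (yh_t _ _ _); apply: val_inj.
by rewrite -yh_tgl yh_incl_t; congr (yh_t _ _ _ * _); apply: val_inj.
Qed.

Lemma glast_tlastX n s :
  glast n * tlast n.+1 ^+ s = incl (tlast n ^+ s) * glast n.
Proof.
elim: s => [|s IH]; first by rewrite yh_incl1 mul1r mulr1.
by rewrite exprSr mulrA IH -mulrA glast_tlast exprSr inclM mulrA.
Qed.

Lemma tlastX_glast n s :
  tlast n.+1 ^+ s * glast n = glast n * incl (tlast n ^+ s).
Proof.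
elim: s => [|s IH]; first by rewrite yh_incl1 mul1r mulr1.
by rewrite exprSr -mulrA tlast_glast mulrA IH -mulrA -inclM -exprSr.
Qed.

Lemma ord_maxE n (i : 'I_n.+1) : i.+1 = n.+1 -> i = ord_max.
Proof. by move=> [Hi]; apply: val_inj. Qed.

(** In the product t (a g b), the new t passes a and then becomes the framing
generator of the previous level when it crosses g. *)
Lemma lstable_tlast n : lstable (@tower_span n) (tlast n).
Proof.
apply: lstable_tower_span => [a s|i a b].
  by rewrite mulrA -commute_incl_tlast -mulrA -exprS; apply: TowerT.
case: n i a b => [|n] i a b; first by case: i.
move=> /[dup] /ord_maxE -> Hi.
rewrite !mulrA -commute_incl_tlast -[incl a * _ * _]mulrA tlast_glast.
by rewrite mulrA -[_ * _ * incl b]mulrA -inclM; apply: TowerG.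
Qed.

Lemma yh_t_lastVincl n (j : 'I_n.+1) :
  j = ord_max \/ exists j', yh_t q d j = incl (yh_t q d j').
Proof.
case: (unliftP ord_max j) => [j' ->|]; [right; exists j'|by left].
by rewrite yh_incl_t; congr (yh_t _ _ _); apply: val_inj; rewrite /= /bump leqNgt ltn_ord.
Qed.

Lemma lstable_t n j : lstable (@tower_span n) (yh_t q d j).
Proof.
case: (yh_t_lastVincl j) => [->|[j' ->]]; first exact: lstable_tlast.
exact: lstable_incl.
Qed.

(** The quadratic relation turns g g b into b + (q - q^-1) e g b, and e is made
of powers of framing generators, under which the span is already stable. *)
Lemma glast_glast_incl n (b : Y n.+1) :
  tower_span (glast n * (glast n * incl b)).
Proof.
have Hg : tower_span (glast n * incl b).
  by rewrite -[glast n]mul1r -yh_incl1; apply: TowerG.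
rewrite mulrA -expr2 yh_g_sqr mulrDl mul1r -aq_scaleAl -mulrA.
apply: TowerD.
  by rewrite -[incl b]mulr1 -(expr0 (tlast n.+1)); apply: TowerT.
apply: subspaceZ (tower_span_subspace _) _ _ _.
by apply: lstable_e Hg => //; [exact: tower_span_subspace|exact: lstable_t].
Qed.

(** The heart of the spanning statement, reducing g (a g b) to at most one
occurrence of g by means of the spanning set of the level of a. *)
Lemma lstable_glast n : (forall x : Y n.+1, tower_span x) ->
  lstable (@tower_span n.+1) (glast n).
Proof.
move=> span_n; apply: lstable_tower_span => [a s|i a b /ord_maxE -> {i}].
  rewrite commute_incl_tlastX mulrA glast_tlastX; exact: TowerG.
elim: (span_n a) b => {a} [a s|i a a' Hi||x y _ Hx _ Hy] b.
(* g a t'^s g b = a t^s g g b *)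
- rewrite inclM !mulrA -commute_incl_glast -(mulrA (incl (incl a))) -tlastX_glast.
  rewrite -!mulrA; apply: lstable_incl.
  exact: lstableX (@lstable_tlast _) _ (glast_glast_incl _).
- case: n span_n i Hi a a' b => [|n] span_n i Hi a a' b; first by case: i {Hi}.
  (* g a g' a' g b = a (g g' g) a' b = (a g') g (g' a' b) *)
  rewrite (ord_maxE Hi) {i Hi}.
  have braid : glast n.+1 * incl (glast n) * glast n.+1 =
      incl (glast n) * glast n.+1 * incl (glast n).
    by rewrite yh_incl_g yh_braid.
  have -> : glast n.+1 * (incl (incl a * glast n * incl a') * glast n.+1 * incl b)
      = incl (incl a * glast n) * glast n.+1 * incl (glast n * incl a' * b).
    rewrite !inclM !mulrA -commute_incl_glast -[_ * incl (incl a') * _]mulrA.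
    rewrite (commute_incl_glast a') !mulrA.
    by rewrite -!(mulrA (incl (incl a))) braid !mulrA.
  exact: TowerG.
- by rewrite linear0 !mul0r mulr0; apply: Tower0.
- by rewrite linearD !mulrDl mulrDr; apply: TowerD.
Qed.

Lemma yh_g_lastVincl n (i : 'I_n.+1) :
  i = ord_max \/ exists i', yh_g q d (n := n.+2) i = incl (yh_g q d (n := n.+1) i').
Proof.
case: (unliftP ord_max i) => [i' ->|]; [right; exists i'|by left].
by rewrite yh_incl_g; congr (yh_g _ _ _); apply: val_inj; rewrite /= /bump leqNgt ltn_ord.
Qed.

Lemma tower_span1 n : tower_span (1 : Y n.+1).
Proof.
by rewrite -[1]mulr1 -{1}(@yh_incl1 K q d n) -(expr0 (tlast n)); apply: TowerT.
Qed.

(** By [yh_ind] it suffices that the span be stable under the generators: those of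
the previous level are clear, and the last g is the reason for the induction, as
[lstable_glast] uses the spanning statement one level below. *)
Lemma tower_spanT n (x : Y n.+1) : tower_span x.
Proof.
elim: n x => [|n IH];
  apply: (yh_ind d_gt0 (@tower_span_subspace _)) => [|i|j]; try exact: lstable_t.
- exact: tower_span1.
- by case: i.
- exact: tower_span1.
- case: (yh_g_lastVincl i) => [->|[i' ->]]; first exact: lstable_glast.
  exact: lstable_incl.
Qed.

(** * Reversal and the trace *)

Lemma eq_subspace n (V : lmodType K) (f h : {linear Y n -> V}) :
  subspace (fun a => f a = h a).
Proof. by split=> [|c x y Ex Ey]; rewrite ?linear0 // !linearP Ex Ey. Qed.

Lemma yh_rev_incl n (a : Y n) : yh_rev (incl a) = incl (yh_rev a).
Proof.
elim/(@yh_ind K q d n d_gt0): a.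
- exact: (eq_subspace (@yh_rev K q d n.+1 \o @yh_incl K q d n)
                      (@yh_incl K q d n \o @yh_rev K q d n)).
- by rewrite yh_incl1 !yh_rev1 yh_incl1.
- by move=> i x Px; rewrite inclM !yh_revM Px yh_incl_g !yh_rev_g inclM yh_incl_g.
- by move=> i x Px; rewrite inclM !yh_revM Px yh_incl_t !yh_rev_t inclM yh_incl_t.
Qed.

Variable tr : forall m, {linear Y m -> {mpoly K[d]}}.
Hypothesis trP : juyumaya_trace d_gt0 tr.

Lemma tr_rev n (a : Y n) : tr n a = tr n (yh_rev a).
Proof.
elim: n a => [|n IH] a.
  apply: (yh_ind d_gt0 (eq_subspace (tr 0) (tr 0 \o @yh_rev K q d 0))).
  - by rewrite /= yh_rev1.
  - by case.
  - by case.
elim: (tower_spanT a) => {a} [a s|i a b Hi||x y _ Ex _ Ey].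
- have revX k : yh_rev (tlast n ^+ k) = tlast n ^+ k.
    elim: k => [|k IHk]; first exact: yh_rev1.
    by rewrite {1}exprSr yh_revM IHk yh_rev_t exprS.
  (* The rules for t cover the exponents below d only, and t has order dividing d. *)
  rewrite yh_revM revX yh_rev_incl -commute_incl_tlastX yh_tX_mod.
  have lt_sd : (s %% d < d)%N by rewrite ltn_mod.
  case: (posnP (s %% d)) => [->|s_gt0].
    by rewrite !mulr1 !(juyumaya_incl trP) IH.
  by rewrite !(juyumaya_t trP _ (s := Ordinal lt_sd)) // IH.
- case: n IH i Hi a b => [|n] IH i Hi a b; first by case: i {Hi}.
  rewrite (ord_maxE Hi) {i Hi}.
  rewrite !yh_revM !yh_rev_incl yh_rev_g mulrA.
  rewrite [LHS](juyumaya_comm trP) [RHS](juyumaya_comm trP).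
  by rewrite !mulrA -!inclM !(juyumaya_g trP) -yh_revM -IH.
- by rewrite !linear0.
- by rewrite !linearD Ex Ey.
Qed.
End Tower.

Unset Implicit Arguments.

Theorem proposition3p1 (R : realType) (q : R[i]) (d n : nat)
    (q_neq0 : q != 0) (d_gt0 : (0 < d)%N)
    (tr : forall m : nat, {linear yokonuma_hecke q d m -> {mpoly R[i][d]}})
    (trP : juyumaya_trace d_gt0 tr) :
  (forall a : yokonuma_hecke q d n, tr n a = tr n (yh_rev a)) /\
  (forall alpha : framed_braid n,
    tr n (yh_of_braid q d alpha) = tr n (yh_of_braid q d (fb_rev alpha))).
Proof.
split=> [a|alpha]; first exact: (tr_rev trP).
by rewrite /yh_of_braid fb_reduce_rev -yh_rev_group -(tr_rev trP).
Qed.
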